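(* Let $\Gamma$ be any set of sequents and let $\Gamma^\exists=\{A^\exists\Rightarrow B^\exists \mid A\Rightarrow B\in\Gamma\}$, and assume $\mathbb N\models\Gamma^\exists$ (i.e. for each $C\Rightarrow D$ in $\Gamma^\exists$, the universal closure of $C\to D$ is true in the standard model $\mathbb N$). If a function $f:\mathbb N^n\to\mathbb N$ is defined by a formula $A(\mathbf x,y)$ in the theory $\mathbf{BA}+\Gamma^\exists$, then $f$ is also defined in $\mathbf{BA}+\Gamma^\exists$ by the $\exists_1^+$ formula $A^\exists(\mathbf x,y)$. Consequently $\mathrm{PT}(\mathbf{BA}+\Gamma^\exists)=\mathrm{PR}(\mathbf{BA}+\Gamma^\exists)$.
   Context: Language and formulas: the arithmetic language is $\mathcal L=\{0,S,+,\cdot\}$; $s<t$ abbreviates $\exists x(s+Sx=t)$ ($x$ fresh), $s\le t$ abbreviates $s<t\lor s=t$. Formulas of basic logic are built from atomic formulas (equations $s=t$, $\top$, $\bot$) using $\land,\lor,\exists x$, and the universal-implication former: if $A,B$ are formulas and $\mathbf x$ is a finite (possibly empty) sequence of distinct variables then $\forall\mathbf x(A\to B)$ is a formula (for empty $\mathbf x$ it is the implication $A\to B$; $\neg A$ means $A\to\bot$). Theories prove sequents $A\Rightarrow B$; ''$T\vdash A$'' means $T\vdash\top\Rightarrow A$. Basic Predicate Calculus $\mathbf{BQC}$ has axioms: $A\Rightarrow A$; $A\Rightarrow\top$; $\bot\Rightarrow A$; $A\land(B\lor C)\Rightarrow(A\land B)\lor(A\land C)$; $A\land\exists xB\Rightarrow\exists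 x(A\land B)$ ($x$ not free in $A$); $\top\Rightarrow x=x$; $x=y\land A\Rightarrow A[x/y]$ ($A$ atomic); $\forall\mathbf x(A\to B)\land\forall\mathbf x(B\to C)\Rightarrow\forall\mathbf x(A\to C)$; $\forall\mathbf x(A\to B)\land\forall\mathbf x(A\to C)\Rightarrow\forall\mathbf x(A\to B\land C)$; $\forall\mathbf x(B\to A)\land\forall\mathbf x(C\to A)\Rightarrow\forall\mathbf x(B\lor C\to A)$; $\forall\mathbf x(A\to B)\Rightarrow\forall\mathbf x(A[\mathbf x/\mathbf t]\to B[\mathbf x/\mathbf t])$; $\forall\mathbf x(A\to B)\Rightarrow\forall\mathbf y(A\to B)$ (no variable of $\mathbf y$ free on the left); $\forall\mathbf y x(B\to A)\Rightarrow\forall\mathbf y(\exists xB\to A)$ ($x$ not free in $A$); and rules: from $A\Rightarrow B$, $B\Rightarrow C$ infer $A\Rightarrow C$; $A\Rightarrow B\land C$ iff both $A\Rightarrow B$ and $A\Rightarrow C$; $B\lor C\Rightarrow A$ iff both $B\Rightarrow A$ and $C\Rightarrow A$; from $A\Rightarrow B$ infer $A[\mathbf x/\mathbf t]\Rightarrow B[\mathbf x/\mathbf t]$; $\exists xB\Rightarrow A$ iff $B\Rightarrow A$ ($x$ not free in $A$); from $A\land B\Rightarrow C$ infer $A\Rightarrow\forall\mathbf x(B\to C)$ (no variable of $\mathbf x$ free in $A$); substitutions are capture-free. Basic Arithmetic $\mathbf{BA}$ is $\mathbf{BQC}$ plus: $Sx=0\Rightarrow\bot$; $Sx=Sy\Rightarrow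 x=y$; $x+0=x$; $x+Sy=S(x+y)$; $x\cdot0=0$; $x\cdot Sy=x\cdot y+x$; the induction axiom schema $\forall\mathbf y x(A\to A[x/Sx])\Rightarrow\forall\mathbf y x(A[x/0]\to A)$; and the induction rule: from $A\Rightarrow A[x/Sx]$ infer $A[x/0]\Rightarrow A$. $\mathbf{BA}+\Gamma^\exists$ is $\mathbf{BA}$ with the sequents of $\Gamma^\exists$ added as axioms. Positive part: $A^\exists$ is defined by $A^\exists=A$ for atomic $A$; $(A'\circ A'')^\exists=A'^\exists\circ A''^\exists$ for $\circ\in\{\land,\lor\}$; $(\exists u A')^\exists=\exists u A'^\exists$; $(\forall\mathbf u(A'\to A''))^\exists=\top$. Classes: $\Delta_0$ is the smallest class containing atomic formulas, closed under $\land,\lor,\to$ and bounded quantification $\exists x(x<s\land A)$, $\forall x(x<s\to A)$; $\Sigma_1$ formulas are $\exists\mathbf xA$ with $A\in\Delta_0$; $\exists_1^+$ formulas are $\exists\mathbf xA$ with $A$ quantifier-free and containing no $\to$ (and hence no $\forall$). Definability: a formula $A(\mathbf x,y)$ defines $f:\mathbb N^n\to\mathbb N$ in $\mathbb N$ if for all $\mathbf a,b$, $\mathbb N\models A(\mathbf a,b)$ iff $f(\mathbf a)=b$. Its existence sequent is $\top\Rightarrow\exists yA(\mathbf x,y)$ and its uniqueness sequent is $A(\mathbf x,u)\land A(\mathbf x,v)\Rightarrow u=v$ ($u,v$ fresh). $A$ defines $f$ in a theory $T$ if it defines $f$ in $\mathbb N$ and $T$ proves its existence and uniqueness sequents. $\mathrm{PT}(T)$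 is the set of functions defined in $T$ by some formula (provably total), and $\mathrm{PR}(T)$ the set of functions defined in $T$ by some $\Sigma_1$ formula (provably recursive). *)

(* Defs.v *)
From mathcomp Require Import all_boot.

Set Implicit Arguments.
Unset Strict Implicit.
Unset Printing Implicit Defensive.

Definition var := nat.

Inductive term : Type :=
| tVar of var
| tZero
| tSucc of term
| tAdd of term & term
| tMul of term & term.

Record varseq : Type := VarSeq { vseq :> seq var; vseq_uniq : uniq vseq }.

Definition vnil : varseq := @VarSeq [::] isT.
Definition vone (x : var) : varseq := @VarSeq [:: x] isT.

(* [fAll xs A B] is the universal implication "forall xs (A -> B)", the only
   universal quantifier and the only implication of basic logic. *)
Inductive formula : Type :=
| fTop
| fBot
| fEq of term & term
| fAnd of formula & formula
| fOr of formula & formula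
| fEx of var & formula
| fAll of varseq & formula & formula.

Definition fImp (A B : formula) : formula := fAll vnil A B.

Definition atomic (A : formula) : bool :=
  match A with fTop | fBot | fEq _ _ => true | _ => false end.

Fixpoint tvars (t : term) : seq var :=
  match t with
  | tVar x => [:: x]
  | tZero => [::]
  | tSucc s => tvars s
  | tAdd s u | tMul s u => tvars s ++ tvars u
  end.

Fixpoint fv (A : formula) : seq var :=
  match A with
  | fTop | fBot => [::]
  | fEq s t => tvars s ++ tvars t
  | fAnd B C | fOr B C => fv B ++ fv C
  | fEx x B => [seq z <- fv B | z != x]
  | fAll xs B C => [seq z <- fv B ++ fv C | z \notin vseq xs]
  end.

(* All variables occurring in a formula, bound occurrences included. *)
Fixpoint vars (A : formula) : seq var :=
  match A with
  | fTop | fBot => [::]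
  | fEq s t => tvars s ++ tvars t
  | fAnd B C | fOr B C => vars B ++ vars C
  | fEx x B => x :: vars B
  | fAll xs B C => vseq xs ++ vars B ++ vars C
  end.

Definition shield (xs : seq var) (s : var -> term) : var -> term :=
  fun z => if z \in xs then tVar z else s z.

Fixpoint tsubst (s : var -> term) (t : term) : term :=
  match t with
  | tVar x => s x
  | tZero => tZero
  | tSucc u => tSucc (tsubst s u)
  | tAdd u v => tAdd (tsubst s u) (tsubst s v)
  | tMul u v => tMul (tsubst s u) (tsubst s v)
  end.

(* Substitution for the free occurrences, without renaming of bound variables:
   it is the capture-free substitution exactly when [free_for s A] holds. *)
Fixpoint subst (s : var -> term) (A : formula) : formula :=
  match A with
  | fTop => fTop
  | fBot => fBot
  | fEq t u => fEq (tsubst s t) (tsubst s u)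
  | fAnd B C => fAnd (subst s B) (subst s C)
  | fOr B C => fOr (subst s B) (subst s C)
  | fEx x B => fEx x (subst (shield [:: x] s) B)
  | fAll xs B C => fAll xs (subst (shield xs s) B) (subst (shield xs s) C)
  end.

Fixpoint free_for (s : var -> term) (A : formula) : bool :=
  match A with
  | fTop | fBot | fEq _ _ => true
  | fAnd B C | fOr B C => free_for s B && free_for s C
  | fEx x B =>
      all (fun z => x \notin tvars (s z)) (fv (fEx x B))
      && free_for (shield [:: x] s) B
  | fAll xs B C =>
      [&& all (fun z => ~~ has (mem (vseq xs)) (tvars (s z))) (fv (fAll xs B C)),
          free_for (shield xs s) B & free_for (shield xs s) C]
  end.

(* The simultaneous substitution [xs/ts]. *)
Definition sub (xs : seq var) (ts : seq term) : var -> term :=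
  fun z => if z \in xs then nth tZero ts (index z xs) else tVar z.

Definition sub1 (x : var) (t : term) : var -> term := sub [:: x] [:: t].

Definition sequent : Type := (formula * formula)%type.
Definition theory : Type := sequent -> Prop.

Notation "A =>> B" := ((A, B) : sequent) (at level 90, no associativity).

(* Derivability in BQC extended by the axioms [Ax] and the rules [Ru]
   ([Ru S S'] means "from S infer S'"). *)
Inductive derives (Ax : sequent -> Prop) (Ru : sequent -> sequent -> Prop) :
  theory :=
| d_ax S : Ax S -> derives Ax Ru S
| d_rule S S' : Ru S S' -> derives Ax Ru S -> derives Ax Ru S'
| d_refl A : derives Ax Ru (A =>> A)
| d_top A : derives Ax Ru (A =>> fTop)
| d_bot A : derives Ax Ru (fBot =>> A)
| d_distr A B C :
    derives Ax Ru (fAnd A (fOr B C) =>> fOr (fAnd A B) (fAnd A C))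
| d_ex_distr x A B : x \notin fv A ->
    derives Ax Ru (fAnd A (fEx x B) =>> fEx x (fAnd A B))
| d_eq_refl x : derives Ax Ru (fTop =>> fEq (tVar x) (tVar x))
| d_eq_subst x y A : atomic A ->
    derives Ax Ru (fAnd (fEq (tVar x) (tVar y)) A =>> subst (sub1 x (tVar y)) A)
| d_all_trans xs A B C :
    derives Ax Ru (fAnd (fAll xs A B) (fAll xs B C) =>> fAll xs A C)
| d_all_and xs A B C :
    derives Ax Ru (fAnd (fAll xs A B) (fAll xs A C) =>> fAll xs A (fAnd B C))
| d_all_or xs A B C :
    derives Ax Ru (fAnd (fAll xs B A) (fAll xs C A) =>> fAll xs (fOr B C) A)
| d_all_subst (xs : varseq) ts A B : size ts = size xs ->
    free_for (sub xs ts) A -> free_for (sub xs ts) B ->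
    derives Ax Ru (fAll xs A B =>>
                   fAll xs (subst (sub xs ts) A) (subst (sub xs ts) B))
| d_all_vars (xs ys : varseq) A B : ~~ has (mem (vseq ys)) (fv (fAll xs A B)) ->
    derives Ax Ru (fAll xs A B =>> fAll ys A B)
| d_all_ex (ys ysx : varseq) x A B :
    vseq ysx = rcons ys x -> x \notin fv A ->
    derives Ax Ru (fAll ysx B A =>> fAll ys (fEx x B) A)
| d_cut A B C :
    derives Ax Ru (A =>> B) -> derives Ax Ru (B =>> C) -> derives Ax Ru (A =>> C)
| d_andI A B C :
    derives Ax Ru (A =>> B) -> derives Ax Ru (A =>> C) ->
    derives Ax Ru (A =>> fAnd B C)
| d_andE1 A B C : derives Ax Ru (A =>> fAnd B C) -> derives Ax Ru (A =>> B)
| d_andE2 A B C : derives Ax Ru (A =>> fAnd B C) -> derives Ax Ru (A =>> C)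
| d_orI A B C :
    derives Ax Ru (B =>> A) -> derives Ax Ru (C =>> A) ->
    derives Ax Ru (fOr B C =>> A)
| d_orE1 A B C : derives Ax Ru (fOr B C =>> A) -> derives Ax Ru (B =>> A)
| d_orE2 A B C : derives Ax Ru (fOr B C =>> A) -> derives Ax Ru (C =>> A)
| d_subst (xs : varseq) ts A B : size ts = size xs ->
    free_for (sub xs ts) A -> free_for (sub xs ts) B ->
    derives Ax Ru (A =>> B) ->
    derives Ax Ru (subst (sub xs ts) A =>> subst (sub xs ts) B)
| d_exI x A B : x \notin fv A ->
    derives Ax Ru (B =>> A) -> derives Ax Ru (fEx x B =>> A)
| d_exE x A B : x \notin fv A ->
    derives Ax Ru (fEx x B =>> A) -> derives Ax Ru (B =>> A)
| d_allI (xs : varseq) A B C : ~~ has (mem (vseq xs)) (fv A) ->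
    derives Ax Ru (fAnd A B =>> C) -> derives Ax Ru (A =>> fAll xs B C).

Definition BQC : theory := derives (fun _ => False) (fun _ _ => False).

(* [tSucc (tVar x)] and [tZero] are free for x in every formula, so the
   induction axiom and rule need no [free_for] condition. *)
Definition at_succ (x : var) (A : formula) : formula :=
  subst (sub1 x (tSucc (tVar x))) A.
Definition at_zero (x : var) (A : formula) : formula := subst (sub1 x tZero) A.

Inductive BA_axiom : sequent -> Prop :=
| BA_succ_neq0 x : BA_axiom (fEq (tSucc (tVar x)) tZero =>> fBot)
| BA_succ_inj x y :
    BA_axiom (fEq (tSucc (tVar x)) (tSucc (tVar y)) =>> fEq (tVar x) (tVar y))
| BA_add0 x : BA_axiom (fTop =>> fEq (tAdd (tVar x) tZero) (tVar x))
| BA_addS x y :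
    BA_axiom (fTop =>> fEq (tAdd (tVar x) (tSucc (tVar y)))
                           (tSucc (tAdd (tVar x) (tVar y))))
| BA_mul0 x : BA_axiom (fTop =>> fEq (tMul (tVar x) tZero) tZero)
| BA_mulS x y :
    BA_axiom (fTop =>> fEq (tMul (tVar x) (tSucc (tVar y)))
                           (tAdd (tMul (tVar x) (tVar y)) (tVar x)))
| BA_ind (ys ysx : varseq) x A : vseq ysx = rcons ys x ->
    BA_axiom (fAll ysx A (at_succ x A) =>> fAll ysx (at_zero x A) A).

Inductive BA_rule : sequent -> sequent -> Prop :=
| BA_ind_rule x A : BA_rule (A =>> at_succ x A) (at_zero x A =>> A).

Definition BA_plus (Gamma : sequent -> Prop) : theory :=
  derives (fun S => BA_axiom S \/ Gamma S) BA_rule.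

Fixpoint pos (A : formula) : formula :=
  match A with
  | fTop | fBot | fEq _ _ => A
  | fAnd B C => fAnd (pos B) (pos C)
  | fOr B C => fOr (pos B) (pos C)
  | fEx x B => fEx x (pos B)
  | fAll _ _ _ => fTop
  end.

Definition pos_set (Gamma : sequent -> Prop) : sequent -> Prop :=
  fun S => exists A B : formula, Gamma (A =>> B) /\ S = (pos A =>> pos B).

Fixpoint teval (e : var -> nat) (t : term) : nat :=
  match t with
  | tVar x => e x
  | tZero => 0
  | tSucc s => (teval e s).+1
  | tAdd s u => teval e s + teval e u
  | tMul s u => teval e s * teval e u
  end.

Fixpoint sat (e : var -> nat) (A : formula) : Prop :=
  match A with
  | fTop => True
  | fBot => False
  | fEq s t => teval e s = teval e t
  | fAnd B C => sat e B /\ sat e C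
  | fOr B C => sat e B \/ sat e C
  | fEx x B => exists m : nat, sat (fun z => if z == x then m else e z) B
  | fAll xs B C =>
      forall e' : var -> nat, (forall z, z \notin vseq xs -> e' z = e z) ->
      sat e' B -> sat e' C
  end.

Definition N_models (Gamma : sequent -> Prop) : Prop :=
  forall C D : formula, Gamma (C =>> D) ->
  forall e : var -> nat, sat e C -> sat e D.

(* s < t, with z meant to be fresh. *)
Definition fLt (z : var) (s t : term) : formula :=
  fEx z (fEq (tAdd s (tSucc (tVar z))) t).

(* As usual for bounded quantifiers, x must not occur in the bound s. *)
Inductive Delta0 : formula -> Prop :=
| Delta0_atomic A : atomic A -> Delta0 A
| Delta0_and A B : Delta0 A -> Delta0 B -> Delta0 (fAnd A B)
| Delta0_or A B : Delta0 A -> Delta0 B -> Delta0 (fOr A B)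
| Delta0_imp A B : Delta0 A -> Delta0 B -> Delta0 (fImp A B)
| Delta0_ex x z s A : x \notin tvars s -> z \notin x :: tvars s ->
    Delta0 A -> Delta0 (fEx x (fAnd (fLt z (tVar x) s) A))
| Delta0_all x z s A : x \notin tvars s -> z \notin x :: tvars s ->
    Delta0 A -> Delta0 (fAll (vone x) (fLt z (tVar x) s) A).

Definition exs (xs : seq var) (A : formula) : formula := foldr fEx A xs.

Definition Sigma1 (A : formula) : Prop :=
  exists (xs : seq var) (B : formula), Delta0 B /\ A = exs xs B.

Fixpoint qf_pos (A : formula) : bool :=
  match A with
  | fTop | fBot | fEq _ _ => true
  | fAnd B C | fOr B C => qf_pos B && qf_pos C
  | fEx _ _ | fAll _ _ _ => false
  end.

Definition Exists1pos (A : formula) : Prop :=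
  exists (xs : seq var) (B : formula), qf_pos B /\ A = exs xs B.

Definition assign (n : nat) (xs : n.-tuple var) (y : var)
    (a : n.-tuple nat) (b : nat) : var -> nat :=
  fun z => if z == y then b else nth 0 a (index z xs).

(* [A], written A(xs, y): the variables xs, y are distinct and all the free
   variables of A are among them. *)
Definition displayed (n : nat) (A : formula) (xs : n.-tuple var) (y : var) :
    Prop :=
  uniq (y :: xs) /\ {subset fv A <= y :: xs}.

Definition defines_in_N (n : nat) (A : formula) (xs : n.-tuple var) (y : var)
    (f : n.-tuple nat -> nat) : Prop :=
  displayed A xs y /\
  forall (a : n.-tuple nat) (b : nat), sat (assign xs y a b) A <-> f a = b.

Definition proves_existence (T : theory) (A : formula) (y : var) : Prop :=
  T (fTop =>> fEx y A).

Definition proves_uniqueness (T : theory) (n : nat) (A : formula)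
    (xs : n.-tuple var) (y : var) : Prop :=
  exists u v : var,
  [/\ u != v, u \notin y :: xs ++ vars A, v \notin y :: xs ++ vars A
    & T (fAnd (subst (sub1 y (tVar u)) A) (subst (sub1 y (tVar v)) A)
         =>> fEq (tVar u) (tVar v))].

Definition defines_in (T : theory) (n : nat) (A : formula) (xs : n.-tuple var)
    (y : var) (f : n.-tuple nat -> nat) : Prop :=
  [/\ defines_in_N A xs y f, proves_existence T A y
    & proves_uniqueness T A xs y].

Definition PT (T : theory) (n : nat) (f : n.-tuple nat -> nat) : Prop :=
  exists (A : formula) (xs : n.-tuple var) (y : var), defines_in T A xs y f.

Definition PR (T : theory) (n : nat) (f : n.-tuple nat -> nat) : Prop :=
  exists (A : formula) (xs : n.-tuple var) (y : var),
  Sigma1 A /\ defines_in T A xs y f.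

(* Main.v *)
Require Import Defs.
From mathcomp Require Import all_boot.
From Corelib Require Import Setoid.

(** Taking positive parts maps every axiom and rule of BA + Gamma^E to a
    derivable one, because a universal implication becomes the formula "true";
    so the existence and uniqueness sequents of [A] give those of [pos A].
    In N, [A] implies [pos A], and the (sound) uniqueness sequent of [pos A]
    shows that [pos A] holds of no further value, hence it defines the same
    function.  Finally [pos A] has a prenex form over BQC. *)

Set Implicit Arguments.
Unset Strict Implicit.
Unset Printing Implicit Defensive.

(** * Substitution *)

Lemma exists_fresh (l : seq var) : exists z : var, z \notin l.
Proof.
exists (\max_(i <- l) i).+1; apply/negP => h.
by have := @leq_bigmax_seq _ l predT id _ h isT; rewrite ltnn.
Qed.

Lemma tsubst_ext s s' t :
  {in tvars t, s =1 s'} -> tsubst s t = tsubst s' t.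
Proof.
elim: t => [x|//|t IH|t IHt u IHu|t IHt u IHu] //= h.
- by apply: h; rewrite inE.
- by rewrite IH.
- by rewrite IHt ?IHu // => z hz; apply: h; rewrite mem_cat hz ?orbT.
- by rewrite IHt ?IHu // => z hz; apply: h; rewrite mem_cat hz ?orbT.
Qed.

Lemma tsubst_id s t : {in tvars t, s =1 tVar} -> tsubst s t = t.
Proof.
move=> /tsubst_ext ->.
by elim: t => //= [t -> | t -> u -> | t -> u ->].
Qed.

Lemma subst_ext s s' A : {in fv A, s =1 s'} -> subst s A = subst s' A.
Proof.
elim: A s s' => [||t u|A IHA B IHB|A IHA B IHB|x A IHA|xs A IHA B IHB] s s' h //=.
- by congr fEq; apply: tsubst_ext => z hz; apply: h; rewrite /= mem_cat hz ?orbT.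
- by congr fAnd; [apply: IHA | apply: IHB] => z hz; apply: h;
    rewrite /= mem_cat hz ?orbT.
- by congr fOr; [apply: IHA | apply: IHB] => z hz; apply: h;
    rewrite /= mem_cat hz ?orbT.
- congr fEx; apply: IHA => z hz; rewrite /shield inE; case: eqP => // /eqP zx.
  by apply: h; rewrite /= mem_filter zx.
- congr fAll; [apply: IHA | apply: IHB] => z hz; rewrite /shield;
    by case: ifP => // zx; apply: h; rewrite /= mem_filter zx mem_cat hz ?orbT.
Qed.

Lemma subst_id s A : {in fv A, s =1 tVar} -> subst s A = A.
Proof.
move=> /subst_ext ->.
elim: A => [||t u|A IHA B IHB|A IHA B IHB|x A IHA|xs A IHA B IHB] //=.
- by rewrite !tsubst_id.
- by rewrite IHA IHB.
- by rewrite IHA IHB.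
- by rewrite -[RHS]/(fEx x A) -{2}IHA; congr fEx; apply: subst_ext => z _;
    rewrite /shield; case: ifP.
- by rewrite -[RHS]/(fAll xs A B) -{2}IHA -{2}IHB; congr fAll;
    apply: subst_ext => z _; rewrite /shield; case: ifP.
Qed.

Lemma tsubst_comp s s' t :
  tsubst s' (tsubst s t) = tsubst (fun z => tsubst s' (s z)) t.
Proof. by elim: t => //= [t -> | t -> u -> | t -> u ->]. Qed.

(** Freeness keeps the variables bound in [A] out of the terms that [s] puts in their scope, so [s']
    acts on those terms alike with and without its shield. *)
Lemma subst_comp s s' A : free_for s A ->
  subst s' (subst s A) = subst (fun z => tsubst s' (s z)) A.
Proof.
elim: A s s' => [||t u|A IHA B IHB|A IHA B IHB|x A IHA|xs A IHA B IHB] s s' //=.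
- by rewrite !tsubst_comp.
- by case/andP=> hA hB; rewrite IHA ?IHB.
- by case/andP=> hA hB; rewrite IHA ?IHB.
- case/andP=> /allP hx hA; rewrite IHA //; congr fEx; apply: subst_ext => z hz.
  rewrite /shield inE; case: eqP => [->|/eqP zx] /=; first by rewrite inE eqxx.
  apply: tsubst_ext => w hw; rewrite inE; case: eqP => // wx.
  by move: (hx z); rewrite mem_filter zx hz -wx hw => /(_ isT).
- case/and3P=> /allP hx hA hB; rewrite IHA // IHB //.
  have E z : z \in fv A ++ fv B ->
    tsubst (shield xs s') (shield xs s z)
    = shield xs (fun z => tsubst s' (s z)) z.
    move=> hz; rewrite /shield; case: ifP => zx /=; first by rewrite zx.
    apply: tsubst_ext => w hw; case: ifP => // wx.
    move: (hx z); rewrite mem_filter zx hz => /(_ isT) /hasPn /(_ w hw) /=.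
    by rewrite /= wx.
  by congr fAll; apply: subst_ext => z hz; apply: E; rewrite mem_cat hz ?orbT.
Qed.

Lemma fv_vars A : {subset fv A <= vars A}.
Proof.
elim: A => [||t u|A IHA B IHB|A IHA B IHB|x A IHA|xs A IHA B IHB] z //=.
- by rewrite !mem_cat => /orP [/IHA|/IHB] ->; rewrite ?orbT.
- by rewrite !mem_cat => /orP [/IHA|/IHB] ->; rewrite ?orbT.
- by rewrite mem_filter inE => /andP [_ /IHA ->]; rewrite orbT.
- by rewrite mem_filter !mem_cat => /andP [_ /orP [/IHA|/IHB] ->]; rewrite !orbT.
Qed.

(** Capture can only occur at a quantified variable, so it is enough for fresh variables to avoid
    this list, which substitution without renaming leaves unchanged. *)
Fixpoint bv (A : formula) : seq var :=
  match A with
  | fTop | fBot | fEq _ _ => [::]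
  | fAnd B C | fOr B C => bv B ++ bv C
  | fEx x B => x :: bv B
  | fAll xs B C => vseq xs ++ bv B ++ bv C
  end.

Lemma bv_vars A : {subset bv A <= vars A}.
Proof.
elim: A => [||t u|A IHA B IHB|A IHA B IHB|x A IHA|xs A IHA B IHB] z //=.
- by rewrite !mem_cat => /orP [/IHA|/IHB] ->; rewrite ?orbT.
- by rewrite !mem_cat => /orP [/IHA|/IHB] ->; rewrite ?orbT.
- by rewrite !inE => /orP [->//|/IHA ->]; rewrite orbT.
- by rewrite !mem_cat => /or3P [->//|/IHA ->|/IHB ->]; rewrite !orbT.
Qed.

Lemma bv_subst s A : bv (subst s A) = bv A.
Proof.
elim: A s => [||t u|A IHA B IHB|A IHA B IHB|x A IHA|xs A IHA B IHB] s //=;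
  by rewrite ?IHA ?IHB.
Qed.

(** A variable [w] of [s z] is captured only below a quantifier on [w]. If [w] is not in [bv A]
    there is none; if [w = z], that quantifier shields [z] itself. The second case admits
    [x := Sx]. *)
Lemma free_for_fresh s A :
  (forall z w, w \in tvars (s z) -> w = z \/ w \notin bv A) -> free_for s A.
Proof.
elim: A s => [||t u|A IHA B IHB|A IHA B IHB|x A IHA|xs A IHA B IHB] s h //=.
- by apply/andP; split; [apply: IHA | apply: IHB] => z w /h [->|];
    [left | rewrite /= mem_cat negb_or => /andP [? ?]; right
    |left | rewrite /= mem_cat negb_or => /andP [? ?]; right].
- by apply/andP; split; [apply: IHA | apply: IHB] => z w /h [->|];
    [left | rewrite /= mem_cat negb_or => /andP [? ?]; right
    |left | rewrite /= mem_cat negb_or => /andP [? ?]; right].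
- apply/andP; split.
    apply/allP => z; rewrite mem_filter => /andP [zx _]; apply/negP => /h [xz|].
      by rewrite xz eqxx in zx.
    by rewrite /= inE eqxx.
  apply: IHA => z w; rewrite /shield; case: ifP => _; first by rewrite inE => /eqP; left.
  by move=> /h [->|]; [left | rewrite /= inE negb_or => /andP [? ?]; right].
- apply/and3P; split.
  + apply/allP => z; rewrite mem_filter => /andP [zx _]; apply/hasPn => w /h [->//|].
    by rewrite /= mem_cat negb_or => /andP [].
  + apply: IHA => z w; rewrite /shield; case: ifP => _; first by rewrite inE => /eqP; left.
    by move=> /h [->|]; [left | rewrite /= !mem_cat !negb_or => /and3P [? ? ?]; right].
  + apply: IHB => z w; rewrite /shield; case: ifP => _; first by rewrite inE => /eqP; left.
    by move=> /h [->|]; [left | rewrite /= !mem_cat !negb_or => /and3P [? ? ?]; right].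
Qed.

Lemma sub1E x t z : sub1 x t z = if z == x then t else tVar z.
Proof.
rewrite /sub1 /sub inE; case: eqP => [->|//].
by rewrite /= eqxx.
Qed.

Lemma free_for_sub1 x t A :
  (forall w, w \in tvars t -> w = x \/ w \notin bv A) -> free_for (sub1 x t) A.
Proof.
move=> h; apply: free_for_fresh => z w; rewrite sub1E.
by case: eqP => [->|_]; [apply: h | rewrite inE => /eqP; left].
Qed.

Lemma free_for_rename x u A : u \notin bv A -> free_for (sub1 x (tVar u)) A.
Proof. by move=> hu; apply: free_for_sub1 => w; rewrite inE => /eqP ->; right. Qed.

Lemma free_for_succ x A : free_for (sub1 x (tSucc (tVar x))) A.
Proof. by apply: free_for_sub1 => w; rewrite inE => /eqP ->; left. Qed.

Lemma free_for_zero x A : free_for (sub1 x tZero) A.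
Proof. by apply: free_for_sub1. Qed.

Lemma mem_tvars_tsubst s t w :
  w \in tvars (tsubst s t) -> exists2 z, z \in tvars t & w \in tvars (s z).
Proof.
elim: t => [x|//|t IH|t IHt u IHu|t IHt u IHu] //=.
- by exists x; rewrite ?inE.
- by rewrite mem_cat => /orP [/IHt|/IHu] [z hz hw]; exists z;
    rewrite // mem_cat hz ?orbT.
- by rewrite mem_cat => /orP [/IHt|/IHu] [z hz hw]; exists z;
    rewrite // mem_cat hz ?orbT.
Qed.

Lemma mem_fv_subst s A w :
  w \in fv (subst s A) -> exists2 z, z \in fv A & w \in tvars (s z).
Proof.
elim: A s => [||t u|A IHA B IHB|A IHA B IHB|x A IHA|xs A IHA B IHB] s //=.
- by rewrite mem_cat => /orP [] /mem_tvars_tsubst [z hz hw]; exists z;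
    rewrite // mem_cat hz ?orbT.
- by rewrite mem_cat => /orP [/IHA|/IHB] [z hz hw]; exists z;
    rewrite // mem_cat hz ?orbT.
- by rewrite mem_cat => /orP [/IHA|/IHB] [z hz hw]; exists z;
    rewrite // mem_cat hz ?orbT.
- rewrite mem_filter => /andP [wx /IHA [z hz]]; rewrite /shield inE.
  case: eqP => [->|/eqP zx hw]; first by rewrite inE (negbTE wx).
  by exists z; rewrite // mem_filter zx.
- rewrite mem_filter mem_cat => /andP [wx /orP [/IHA|/IHB] [z hz]];
    rewrite /shield; case: ifP => [zx|zx hw];
    try (by rewrite inE => /eqP wz; rewrite wz zx in wx);
    by exists z; rewrite // mem_filter zx mem_cat hz ?orbT.
Qed.

(** * Soundness in the standard model *)

Lemma teval_ext e e' t : {in tvars t, e =1 e'} -> teval e t = teval e' t.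
Proof.
elim: t => [x|//|t IH|t IHt u IHu|t IHt u IHu] //= h.
- by apply: h; rewrite inE.
- by rewrite IH.
- by rewrite IHt ?IHu // => z hz; apply: h; rewrite mem_cat hz ?orbT.
- by rewrite IHt ?IHu // => z hz; apply: h; rewrite mem_cat hz ?orbT.
Qed.

Lemma teval_subst e s t :
  teval e (tsubst s t) = teval (fun z => teval e (s z)) t.
Proof. by elim: t => //= [t -> | t -> u -> | t -> u ->]. Qed.

Lemma sat_ext_imp e e' A : {in fv A, e =1 e'} -> sat e A -> sat e' A.
Proof.
elim: A e e' => [||t u|A IHA B IHB|A IHA B IHB|x A IHA|xs A IHA B IHB] e e' h //=.
- by rewrite !(@teval_ext e e') // => z hz; apply: h; rewrite /= mem_cat hz ?orbT.
- by case=> hA hB; split; [apply: IHA hA | apply: IHB hB] => z hz; apply: h;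
    rewrite /= mem_cat hz ?orbT.
- by case=> hA; [left; apply: IHA hA | right; apply: IHB hA] => z hz; apply: h;
    rewrite /= mem_cat hz ?orbT.
- case=> m hm; exists m; apply: IHA hm => z hz; case: eqP => // /eqP zx.
  by apply: h; rewrite /= mem_filter zx.
- move=> H d' hd' hA.
  (* [d] is admissible for [H], as it differs from [e] only on [xs], and it agrees with [d'] on the
     free variables of [A] and [B]. *)
  pose d z := if z \in vseq xs then d' z else e z.
  have E z : z \in fv A ++ fv B -> d z = d' z.
    move=> hz; rewrite /d; case: ifP => // zx; rewrite hd' ?zx //.
    by apply: h; rewrite /= mem_filter zx.
  have hAB : sat d A -> sat d B by apply: H => z zx; rewrite /d (negbTE zx).
  have: sat d A by apply: IHA hA => z hz; rewrite E // mem_cat hz.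
  by move/hAB; apply: IHB => z hz; rewrite E // mem_cat hz orbT.
Qed.

Lemma sat_ext e e' A : {in fv A, e =1 e'} -> sat e A <-> sat e' A.
Proof. by move=> h; split; apply: sat_ext_imp => z hz; rewrite h. Qed.

Lemma sat_subst e s A : free_for s A ->
  sat e (subst s A) <-> sat (fun z => teval e (s z)) A.
Proof.
elim: A e s => [||t u|A IHA B IHB|A IHA B IHB|x A IHA|xs A IHA B IHB] e s //=.
- by rewrite !teval_subst.
- by case/andP=> hA hB; rewrite IHA // IHB.
- by case/andP=> hA hB; rewrite IHA // IHB.
- case/andP=> /allP hx hA.
  have E m : {in fv A, (fun z => teval (fun y => if y == x then m else e y)
                                   (shield [:: x] s z))
                =1 (fun z => if z == x then m else teval e (s z))}.
    move=> z hz; rewrite /shield inE; case: eqP => [->|/eqP zx] /=.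
      by rewrite eqxx.
    apply: teval_ext => w hw; case: eqP => // wx.
    by move: (hx z); rewrite mem_filter zx hz -wx hw => /(_ isT).
  by split=> -[m hm]; exists m; move: hm; rewrite IHA // (sat_ext (E m)).
- case/and3P=> /allP hx hA hB.
  (* Under the quantifier, an assignment [d] for the substituted formula corresponds to the [d']
     that copies [d] on [xs] and evaluates [s] under [e] elsewhere. Each direction below builds the
     missing one of the two. *)
  have E d d' : (forall z, z \notin vseq xs -> d z = e z) ->
      (forall z, d' z = if z \in vseq xs then d z else teval e (s z)) ->
    {in fv A ++ fv B, (fun z => teval d (shield xs s z)) =1 d'}.
    move=> hd hd' z hz; rewrite hd' /shield; case: ifP => zx //=.
    apply: teval_ext => w hw; rewrite hd //.
    by move: (hx z); rewrite mem_filter zx hz => /(_ isT) /hasPn /(_ w hw).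
  have EA d d' : (forall z, z \notin vseq xs -> d z = e z) ->
      (forall z, d' z = if z \in vseq xs then d z else teval e (s z)) ->
    sat d (subst (shield xs s) A) <-> sat d' A.
    move=> hd hd'; rewrite IHA //; apply: sat_ext => z hz.
    by apply: (E d d'); rewrite // mem_cat hz.
  have EB d d' : (forall z, z \notin vseq xs -> d z = e z) ->
      (forall z, d' z = if z \in vseq xs then d z else teval e (s z)) ->
    sat d (subst (shield xs s) B) <-> sat d' B.
    move=> hd hd'; rewrite IHB //; apply: sat_ext => z hz.
    by apply: (E d d'); rewrite // mem_cat hz orbT.
  split=> H d hd.
  + pose d0 z := if z \in vseq xs then d z else e z.
    have h1 z : z \notin vseq xs -> d0 z = e z by rewrite /d0 => /negbTE ->.
    have h2 z : d z = if z \in vseq xs then d0 z else teval e (s z).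
      by rewrite /d0; case: (boolP (z \in vseq xs)) => // /hd.
    by rewrite -(EA d0) // -(EB d0) //; apply: H.
  + pose d0 z := if z \in vseq xs then d z else teval e (s z).
    by rewrite (EA d d0) // (EB d d0) //; apply: H => z; rewrite /d0 => /negbTE ->.
Qed.

Lemma sat_sub1 e x t A : free_for (sub1 x t) A ->
  sat e (subst (sub1 x t) A)
  <-> sat (fun z => if z == x then teval e t else e z) A.
Proof.
move=> h; rewrite sat_subst //; apply: sat_ext => z _.
by rewrite sub1E; case: eqP.
Qed.

(** Ordinary induction on the value of [x]. The step is asked only at assignments agreeing with [e]
    off [x], which fits both the induction axiom, where the other variables stay fixed, and the
    rule, where the step is valid everywhere. *)
Lemma sat_induction e x A :
  (forall d, (forall z, z != x -> d z = e z) -> sat d A -> sat d (at_succ x A)) ->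
  sat e (at_zero x A) -> sat e A.
Proof.
move=> hS; rewrite (sat_sub1 _ (free_for_zero x A)) /= => h0.
have H k : sat (fun z => if z == x then k else e z) A.
  elim: k => // k IHk.
  have := hS (fun z => if z == x then k else e z).
  rewrite (sat_sub1 _ (free_for_succ x A)) /= eqxx => /(_ _ IHk) hk.
  apply: sat_ext_imp (hk _) => [z _ | z /negbTE -> //].
  by case: eqP.
by apply: sat_ext_imp (H (e x)) => z _; case: eqP => // ->.
Qed.

Definition valid (S : sequent) : Prop := forall e, sat e S.1 -> sat e S.2.

(** Axioms and rules are left open because soundness serves twice: for arithmetic, and for pure
    [BQC] when a formula is compared in N with its prenex form. *)
Lemma derives_sound Ax Ru S :
  (forall S, Ax S -> valid S) -> (forall S S', Ru S S' -> valid S -> valid S') ->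
  derives Ax Ru S -> valid S.
Proof.
move=> hAx hRu; elim=> {S}.
- by [].
- by move=> S S' /hRu h _.
- by move=> A e.
- by move=> A e.
- by move=> A e [].
- by move=> A B C e /= [hA [hB|hC]]; [left | right].
- move=> x A B hx e /= [hA [m hm]]; exists m; split=> //.
  by apply: sat_ext_imp hA => z hz; case: eqP => // zx; rewrite -zx hz in hx.
- by [].
- move=> x y A hA e /= [exy h]; rewrite sat_sub1; last by case: A hA {h}.
  by apply: sat_ext_imp h => z _ /=; case: eqP => // ->.
- by move=> xs A B C e /= [hAB hBC] d hd /(hAB d hd); apply: hBC.
- by move=> xs A B C e /= [hAB hAC] d hd hA; split; [apply: hAB | apply: hAC].
- by move=> xs A B C e /= [hBA hCA] d hd [hB|hC]; [apply: hBA | apply: hCA].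
- move=> xs ts A B _ hA hB e /= h d hd; rewrite !sat_subst //; apply: h => z zx.
  by rewrite /sub (negbTE zx) /= hd.
- move=> xs ys A B /hasPn hys e /= h d hd hA.
  (* A variable free in [A] or [B] and outside [xs] is not in [ys], so resetting [d] to [e] off [xs]
     changes no value on which [A] or [B] depends. *)
  pose d' z := if z \in vseq xs then d z else e z.
  have E z : z \in fv A ++ fv B -> d' z = d z.
    move=> hz; rewrite /d'; case: ifP => // zx; rewrite hd //.
    by apply: hys; rewrite /= mem_filter zx.
  have hAB : sat d' A -> sat d' B by apply: h => z zx; rewrite /d' (negbTE zx).
  have: sat d' A by apply: sat_ext_imp hA => z hz; rewrite E // mem_cat hz.
  by move/hAB; apply: sat_ext_imp => z hz; rewrite E // mem_cat hz orbT.
- move=> ys ysx x A B eys hx e /= h d hd [m /h hm].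
  apply: sat_ext_imp (hm _) => [z hz | z].
    by case: eqP => // zx; rewrite -zx hz in hx.
  by rewrite eys mem_rcons inE negb_or => /andP [/negbTE -> /hd].
- by move=> A B C _ h1 _ h2 e /h1 /h2.
- by move=> A B C _ h1 _ h2 e he; split; [apply: h1 | apply: h2].
- by move=> A B C _ h e /h [].
- by move=> A B C _ h e /h [].
- by move=> A B C _ h1 _ h2 e [/h1 | /h2].
- by move=> A B C _ h e he; apply: h; left.
- by move=> A B C _ h e he; apply: h; right.
- by move=> xs ts A B _ hA hB _ h e /=; rewrite !sat_subst //; apply: h.
- move=> x A B hx _ h e /= [m /h]; apply: sat_ext_imp => z hz.
  by case: eqP => // zx; rewrite -zx hz in hx.
- move=> x A B hx _ h e /= he; apply: h; exists (e x).
  by apply: sat_ext_imp he => z _; case: eqP => // ->.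
- move=> xs A B C /hasPn hxs _ h e /= hA d hd hB; apply: h; split=> //.
  by apply: sat_ext_imp hA => z /hxs zx; rewrite hd.
Qed.

Lemma BQC_sound S : BQC S -> valid S.
Proof. exact: derives_sound. Qed.

Lemma BA_plus_sound Gamma S : N_models Gamma -> BA_plus Gamma S -> valid S.
Proof.
move=> hG; apply: derives_sound => {S} [S [|]|S S'].
- case=> {S}.
  + by [].
  + by move=> x y e /= [].
  + by move=> x e _ /=; rewrite addn0.
  + by move=> x y e _ /=; rewrite addnS.
  + by move=> x e _ /=; rewrite muln0.
  + by move=> x y e _ /=; rewrite mulnS addnC.
  + move=> ys ysx x A eys e /= h d hd; apply: sat_induction => d' hd'.
    apply: h => z hz; rewrite hd' ?hd //.
    by move: hz; rewrite eys mem_rcons inE negb_or => /andP [].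
- by case: S => A B /hG.
- by case=> x A h e; apply: sat_induction => d _; apply: h.
Qed.

(** * Positive parts *)

(** Makes every sequent of [pos_set Gamma] its own positive part, so that as an axiom it is mapped
    to itself. *)
Lemma pos_idem A : pos (pos A) = pos A.
Proof. by elim: A => //= [A -> B ->|A -> B ->|x A ->]. Qed.

Lemma pos_subst s A : pos (subst s A) = subst s (pos A).
Proof.
by elim: A s => //= [A IHA B IHB|A IHA B IHB|x A IHA] s; rewrite ?IHA ?IHB.
Qed.

Lemma fv_pos A : {subset fv (pos A) <= fv A}.
Proof.
elim: A => //= [t u|A IHA B IHB|A IHA B IHB|x A IHA] z //.
- by rewrite !mem_cat => /orP [/IHA|/IHB] ->; rewrite ?orbT.
- by rewrite !mem_cat => /orP [/IHA|/IHB] ->; rewrite ?orbT.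
- by rewrite !mem_filter => /andP [-> /IHA].
Qed.

Lemma vars_pos A : {subset vars (pos A) <= vars A}.
Proof.
elim: A => //= [t u|A IHA B IHB|A IHA B IHB|x A IHA] z //.
- by rewrite !mem_cat => /orP [/IHA|/IHB] ->; rewrite ?orbT.
- by rewrite !mem_cat => /orP [/IHA|/IHB] ->; rewrite ?orbT.
- by rewrite !inE => /orP [->|/IHA ->]; rewrite ?orbT.
Qed.

Lemma free_for_pos s A : free_for s A -> free_for s (pos A).
Proof.
elim: A s => //= [A IHA B IHB|A IHA B IHB|x A IHA] s.
- by case/andP=> /IHA -> /IHB.
- by case/andP=> /IHA -> /IHB.
- case/andP=> /allP hx /IHA ->; rewrite andbT; apply/allP => z hz; apply: hx.
  by move: hz; rewrite !mem_filter => /andP [-> /fv_pos].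
Qed.

Lemma notin_fv_pos x A : x \notin fv A -> x \notin fv (pos A).
Proof. by apply: contra => /fv_pos. Qed.

(** [pos] does not descend into a universal implication, so whatever it replaces by truth occurs
    positively. *)
Lemma sat_pos e A : sat e A -> sat e (pos A).
Proof.
elim: A e => //= [A IHA B IHB|A IHA B IHB|x A IHA] e.
- by case=> /IHA ? /IHB.
- by case=> [/IHA|/IHB]; [left | right].
- by case=> m /IHA; exists m.
Qed.

(** Each logical axiom or rule that explicitly introduces [fAll] has it as the right-hand side of
    its conclusion, where [pos] makes it [fTop]; every other clause is mapped to an instance of
    itself. *)
Lemma derives_pos Ax Ru S :
  (forall S, Ax S -> derives Ax Ru (pos S.1 =>> pos S.2)) ->
  (forall S S', Ru S S' -> derives Ax Ru (pos S.1 =>> pos S.2) ->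
     derives Ax Ru (pos S'.1 =>> pos S'.2)) ->
  derives Ax Ru S -> derives Ax Ru (pos S.1 =>> pos S.2).
Proof.
move=> hAx hRu; elim=> {S} /=.
- by [].
- by move=> S S' /hRu h _.
- by move=> A; apply: d_refl.
- by move=> A; apply: d_top.
- by move=> A; apply: d_bot.
- by move=> A B C; apply: d_distr.
- by move=> x A B hx; apply: d_ex_distr; apply: notin_fv_pos.
- by move=> x; apply: d_eq_refl.
- move=> x y A hA; rewrite pos_subst; apply: d_eq_subst.
  by case: A hA.
- by move=> *; apply: d_top.
- by move=> *; apply: d_top.
- by move=> *; apply: d_top.
- by move=> *; apply: d_top.
- by move=> *; apply: d_top.
- by move=> *; apply: d_top.
- by move=> A B C _ h1 _; apply: d_cut.
- by move=> A B C _ h1 _; apply: d_andI.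
- by move=> A B C _; apply: d_andE1.
- by move=> A B C _; apply: d_andE2.
- by move=> A B C _ h1 _; apply: d_orI.
- by move=> A B C _; apply: d_orE1.
- by move=> A B C _; apply: d_orE2.
- move=> xs ts A B hs hA hB _; rewrite !pos_subst.
  by apply: d_subst => //; apply: free_for_pos.
- by move=> x A B hx _; apply: d_exI; apply: notin_fv_pos.
- by move=> x A B hx _; apply: d_exE; apply: notin_fv_pos.
- by move=> *; apply: d_top.
Qed.

Lemma BA_plus_pos Gamma A B :
  BA_plus (pos_set Gamma) (A =>> B) ->
  BA_plus (pos_set Gamma) (pos A =>> pos B).
Proof.
apply: (@derives_pos _ _ (A =>> B)) => [S [hS|]|S S'].
(* The arithmetic equations and successor axioms are their own positive parts; the induction axiom
   gets [fTop] on the right. *)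
- case: hS (hS) => * /=; try (by apply: d_ax; left); exact: d_top.
- by case=> C [D [hCD ->]]; rewrite /= !pos_idem; apply: d_ax; right; exists C, D.
(* Since [pos] commutes with substitution, the induction rule for [C] becomes the induction rule for
   [pos C]. *)
- case=> x C /=; rewrite !pos_subst => h.
  by apply: d_rule h; apply: BA_ind_rule.
Qed.

(** * Prenex forms of positive formulas *)

(** Quantifying over all axioms and rules makes one equivalence usable both in [BQC] and in the
    extended arithmetic. *)
Definition equiv (A B : formula) : Prop :=
  forall Ax Ru, derives Ax Ru (A =>> B) /\ derives Ax Ru (B =>> A).

Lemma equiv_refl A : equiv A A.
Proof. by move=> Ax Ru; split; apply: d_refl. Qed.

Lemma equiv_trans B A C : equiv A B -> equiv B C -> equiv A C.
Proof.
move=> h1 h2 Ax Ru; case: (h1 Ax Ru) (h2 Ax Ru) => ? ? [? ?].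
by split; apply: (d_cut (B := B)).
Qed.

Section Connectives.

Variables (Ax : sequent -> Prop) (Ru : sequent -> sequent -> Prop).
Local Notation "A |- B" := (derives Ax Ru (A =>> B)) (at level 95).

(** This and the next introductions and projections, up to [d_ex_intro], are the two-way rules read
    backwards from an identity sequent. *)
Lemma d_andl A B : fAnd A B |- A.
Proof. exact: d_andE1 (d_refl _ _ _). Qed.

Lemma d_andr A B : fAnd A B |- B.
Proof. exact: d_andE2 (d_refl _ _ _). Qed.

Lemma d_orl A B : A |- fOr A B.
Proof. exact: d_orE1 (d_refl _ _ _). Qed.

Lemma d_orr A B : B |- fOr A B.
Proof. exact: d_orE2 (d_refl _ _ _). Qed.

Lemma notin_fv_ex x A : x \notin fv (fEx x A).
Proof. by rewrite mem_filter eqxx. Qed.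

Lemma d_ex_intro x A : A |- fEx x A.
Proof. exact: d_exE (notin_fv_ex x A) (d_refl _ _ _). Qed.

Lemma d_and_mono A A' B B' : A |- A' -> B |- B' -> fAnd A B |- fAnd A' B'.
Proof.
move=> hA hB; apply: d_andI.
- exact: d_cut (d_andl A B) hA.
- exact: d_cut (d_andr A B) hB.
Qed.

Lemma d_or_mono A A' B B' : A |- A' -> B |- B' -> fOr A B |- fOr A' B'.
Proof.
move=> hA hB; apply: d_orI.
- exact: d_cut hA (d_orl A' B').
- exact: d_cut hB (d_orr A' B').
Qed.

Lemma d_ex_mono x A B : A |- B -> fEx x A |- fEx x B.
Proof.
by move=> h; apply: d_exI (notin_fv_ex x B) _; apply: d_cut h (d_ex_intro x B).
Qed.

Lemma d_sub1 x t A B : free_for (sub1 x t) A -> free_for (sub1 x t) B ->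
  A |- B -> subst (sub1 x t) A |- subst (sub1 x t) B.
Proof. exact: (@d_subst _ _ (vone x) [:: t]). Qed.

(** Substitute [t] for [x] in [d_ex_intro]: the right-hand side does not change, because [x] is
    bound there. *)
Lemma d_ex_term x t A : free_for (sub1 x t) A -> subst (sub1 x t) A |- fEx x A.
Proof.
move=> hA.
have E : subst (sub1 x t) (fEx x A) = fEx x A.
  apply: subst_id => z; rewrite mem_filter sub1E => /andP [zx _].
  by rewrite (negbTE zx).
rewrite -E; apply: d_sub1 (d_ex_intro x A) => //=; apply/andP; split.
  apply/allP => z; rewrite mem_filter sub1E => /andP [zx _].
  by rewrite (negbTE zx) inE eq_sym.
apply: free_for_fresh => z w; rewrite /shield inE sub1E.
by case: eqP => _; rewrite inE => /eqP; left.
Qed.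

End Connectives.

Lemma equiv_ex x A B : equiv A B -> equiv (fEx x A) (fEx x B).
Proof. by move=> h Ax Ru; case: (h Ax Ru); split; apply: d_ex_mono. Qed.

Lemma equiv_exs xs A B : equiv A B -> equiv (exs xs A) (exs xs B).
Proof. by move=> h; elim: xs => //= x xs; apply: equiv_ex. Qed.

Lemma equiv_and A A' B B' :
  equiv A A' -> equiv B B' -> equiv (fAnd A B) (fAnd A' B').
Proof.
move=> hA hB Ax Ru; case: (hA Ax Ru) (hB Ax Ru) => ? ? [? ?].
by split; apply: d_and_mono.
Qed.

Lemma equiv_or A A' B B' :
  equiv A A' -> equiv B B' -> equiv (fOr A B) (fOr A' B').
Proof.
move=> hA hB Ax Ru; case: (hA Ax Ru) (hB Ax Ru) => ? ? [? ?].
by split; apply: d_or_mono.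
Qed.

Lemma equiv_andC A B : equiv (fAnd A B) (fAnd B A).
Proof. by move=> Ax Ru; split; apply: d_andI; (apply: d_andr || apply: d_andl). Qed.

Lemma equiv_orC A B : equiv (fOr A B) (fOr B A).
Proof. by move=> Ax Ru; split; apply: d_orI; (apply: d_orr || apply: d_orl). Qed.

(** Left to right is the distribution axiom, wrapped in two commutations because it has the
    quantifier in the second conjunct. *)
Lemma equiv_and_ex x A B : x \notin fv B ->
  equiv (fAnd (fEx x A) B) (fEx x (fAnd A B)).
Proof.
move=> hx Ax Ru; split.
- apply: d_cut (proj1 (equiv_andC _ _ Ax Ru)) _.
  apply: d_cut (d_ex_distr _ _ _ hx) _.
  by apply: d_ex_mono; apply: (proj1 (equiv_andC _ _ Ax Ru)).
- apply: d_exI; last by apply: d_and_mono (d_ex_intro _ _ _ _) (d_refl _ _ _).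
  by rewrite /= mem_cat negb_or hx notin_fv_ex.
Qed.

Lemma equiv_or_ex x A B : x \notin fv B ->
  equiv (fOr (fEx x A) B) (fEx x (fOr A B)).
Proof.
move=> hx Ax Ru; split.
- apply: d_orI; first by apply: d_ex_mono; apply: d_orl.
  by apply: d_cut (d_orr _ _ A B) (d_ex_intro _ _ _ _).
- apply: d_exI; last by apply: d_or_mono (d_ex_intro _ _ _ _) (d_refl _ _ _).
  by rewrite /= mem_cat negb_or hx notin_fv_ex.
Qed.

(** Each direction is an existential introduction with the other variable as witness, since renaming
    [x] to the fresh [z] and back restores [A]. *)
Lemma equiv_ex_rename x z A :
  z != x -> z \notin fv A -> z \notin bv A -> x \notin bv A ->
  equiv (fEx x A) (fEx z (subst (sub1 x (tVar z)) A)).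
Proof.
move=> zx zA hz hx Ax Ru; set A' := subst _ _.
have hzA : free_for (sub1 x (tVar z)) A by apply: free_for_rename.
have xA' : x \notin fv A'.
  apply/negP => /mem_fv_subst [w hw]; rewrite sub1E.
  by case: eqP => [_|/eqP wx]; rewrite inE eq_sym ?(negbTE zx) ?(negbTE wx).
split; apply: d_exI.
- by rewrite mem_filter (negbTE xA') andbF.
- have E : subst (sub1 z (tVar x)) A' = A.
    rewrite subst_comp //; apply: subst_id => w hw.
    rewrite sub1E; case: eqP => [->|_]; rewrite /= sub1E ?eqxx //.
    by case: eqP => // wz; rewrite -wz hw in zA.
  by rewrite -{1}E; apply: d_ex_term; apply: free_for_rename; rewrite bv_subst.
- by rewrite mem_filter (negbTE zA) andbF.
- exact: d_ex_term.
Qed.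

Lemma mem_fv_exs zs A w : (w \in fv (exs zs A)) = (w \in fv A) && (w \notin zs).
Proof.
elim: zs => [|z zs IH] /=; first by rewrite andbT.
by rewrite mem_filter IH inE negb_or andbCA.
Qed.

Lemma bv_exs zs A : bv (exs zs A) = zs ++ bv A.
Proof. by elim: zs => //= z zs ->. Qed.

Lemma vars_exs zs A : vars (exs zs A) = zs ++ vars A.
Proof. by elim: zs => //= z zs ->. Qed.

Lemma exs_cat xs ys A : exs (xs ++ ys) A = exs xs (exs ys A).
Proof. exact: foldr_cat. Qed.

Lemma qf_pos_vars A : qf_pos A -> vars A = fv A.
Proof. by elim: A => //= A IHA B IHB /andP [/IHA -> /IHB ->]. Qed.

Lemma qf_pos_bv A : qf_pos A -> bv A = [::].
Proof. by elim: A => //= A IHA B IHB /andP [/IHA -> /IHB ->]. Qed.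

Lemma qf_pos_subst s A : qf_pos (subst s A) = qf_pos A.
Proof. by elim: A s => //= A IHA B IHB s; rewrite IHA IHB. Qed.

Lemma subst_exs x t zs A : x \notin zs ->
  subst (sub1 x t) (exs zs A) = exs zs (subst (sub1 x t) A).
Proof.
elim: zs => //= z zs IH; rewrite inE negb_or => /andP [xz /IH <-].
congr fEx; apply: subst_ext => w _; rewrite /shield inE sub1E.
by case: eqP => // ->; rewrite eq_sym (negbTE xz).
Qed.

(** Pull out the left prefix, commute, pull out the right prefix, commute back. The connective is
    abstract so that conjunction and disjunction share the argument. *)
Lemma equiv_op_exs (op : formula -> formula -> formula) xs ys A B :
  (forall C C' D D', equiv C C' -> equiv D D' -> equiv (op C D) (op C' D')) ->
  (forall C D, equiv (op C D) (op D C)) ->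
  (forall x C D, x \notin fv D -> equiv (op (fEx x C) D) (fEx x (op C D))) ->
  {in xs, forall x, x \notin fv (exs ys B)} -> {in ys, forall y, y \notin fv A} ->
  equiv (op (exs xs A) (exs ys B)) (exs (xs ++ ys) (op A B)).
Proof.
move=> opM opC opE hxs hys.
have ext zs C D : {in zs, forall z, z \notin fv D} ->
    equiv (op (exs zs C) D) (exs zs (op C D)).
  elim: zs => [|z zs IH] h /=; first exact: equiv_refl.
  apply: equiv_trans (opE _ _ _ (h z (mem_head _ _))) _.
  by apply/equiv_ex/IH => w hw; apply: h; rewrite inE hw orbT.
rewrite exs_cat; apply: equiv_trans (ext _ _ _ hxs) _; apply: equiv_exs.
apply: equiv_trans (opC _ _) _; apply: equiv_trans (ext _ _ _ hys) _.
exact/equiv_exs/opC.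
Qed.

(* The list [l] of forbidden bound variables is what makes the induction pass
   through the binary connectives. *)
Definition has_prenex (A : formula) : Prop :=
  forall l : seq var, exists (zs : seq var) (B : formula),
  [/\ qf_pos B, {in zs, forall z, z \notin l},
     {subset fv (exs zs B) <= fv A} & equiv A (exs zs B)].

Lemma has_prenex_op (op : formula -> formula -> formula) A1 A2 :
  (forall C D, qf_pos (op C D) = qf_pos C && qf_pos D) ->
  (forall C D, fv (op C D) = fv C ++ fv D) ->
  (forall C C' D D', equiv C C' -> equiv D D' -> equiv (op C D) (op C' D')) ->
  (forall C D, equiv (op C D) (op D C)) ->
  (forall x C D, x \notin fv D -> equiv (op (fEx x C) D) (fEx x (op C D))) ->
  has_prenex A1 -> has_prenex A2 -> has_prenex (op A1 A2).
Proof.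
move=> opQ opF opM opC opE IH1 IH2 l.
(* [zs1] will be moved across the whole second formula, hence avoids [fv A2]; [zs2] is moved later,
   across the bare matrix [B1], and avoids [fv B1]. *)
have [zs1 [B1 [q1 d1 f1 e1]]] := IH1 (l ++ fv A2).
have [zs2 [B2 [q2 d2 f2 e2]]] := IH2 (l ++ fv B1).
exists (zs1 ++ zs2), (op B1 B2); split; first by rewrite opQ q1.
- by move=> z; rewrite mem_cat => /orP [/d1|/d2];
    rewrite mem_cat negb_or => /andP [].
- move=> w; rewrite mem_fv_exs !opF !mem_cat negb_or.
  case/andP=> /orP [] hw /andP [w1 w2].
  + by rewrite f1 // mem_fv_exs hw.
  + by rewrite f2 ?orbT // mem_fv_exs hw.
- apply: equiv_trans (opM _ _ _ _ e1 e2) _; apply: equiv_op_exs => // z.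
  + by move/d1; rewrite mem_cat negb_or => /andP [_]; apply: contra => /f2.
  + by move/d2; rewrite mem_cat negb_or => /andP [_].
Qed.

Lemma pos_has_prenex A : has_prenex (pos A).
Proof.
elim: A => [||t u|A IHA B IHB|A IHA B IHB|x A IHA|xs A _ B _] /=;
  try (by move=> l; eexists [::], _; split; last exact: equiv_refl).
- by apply: has_prenex_op => //; [apply: equiv_and | apply: equiv_andC | apply: equiv_and_ex].
- by apply: has_prenex_op => //; [apply: equiv_or | apply: equiv_orC | apply: equiv_or_ex].
(* The quantified [x] may itself be forbidden by [l], so it is renamed to a fresh [z]. Forbidding
   [x] in the inner prefix lets the renaming pass through to the matrix. *)
- move=> l; have [zs [B [qB dB fB eB]]] := IHA (x :: l).
  have [z] := exists_fresh (x :: l ++ zs ++ fv B).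
  rewrite inE !mem_cat !negb_or => /and4P [zx zl zzs zB].
  have xzs : x \notin zs by apply/negP => /dB; rewrite inE eqxx.
  exists (z :: zs), (subst (sub1 x (tVar z)) B); split.
  + by rewrite qf_pos_subst.
  + move=> w; rewrite inE => /orP [/eqP -> //|/dB].
    by rewrite inE negb_or => /andP [].
  + move=> w; rewrite mem_fv_exs inE negb_or => /and3P [/mem_fv_subst [v hv]].
    rewrite sub1E; case: eqP => [_|/eqP vx]; rewrite inE => /eqP ->.
      by rewrite eqxx.
    by move=> _ vzs; rewrite mem_filter vx fB // mem_fv_exs hv.
  + apply: equiv_trans (equiv_ex x eB) _; rewrite /= -subst_exs //.
    apply: equiv_ex_rename => //; rewrite ?bv_exs ?(qf_pos_bv qB) ?cats0 //.
    by rewrite mem_fv_exs (negbTE zB).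
Qed.

(** * Definability *)

Lemma Exists1pos_Sigma1 A : Exists1pos A -> Sigma1 A.
Proof.
case=> xs [B [qB ->]]; exists xs, B; split=> // {xs}.
elim: B qB => //= [|||B IHB C IHC /andP [/IHB ? /IHC ?]
  |B IHB C IHC /andP [/IHB ? /IHC ?]]; by constructor.
Qed.

Lemma unique_sat (T : theory) n A (xs : n.-tuple var) y a b c :
  (forall S, T S -> valid S) -> displayed A xs y -> proves_uniqueness T A xs y ->
  sat (assign xs y a b) A -> sat (assign xs y a c) A -> b = c.
Proof.
move=> hT [_ hfv] [u [v [uv hu hv /hT hval]]] hb hc.
(* The uniqueness sequent is evaluated with the two candidate values at [u] and [v]. The 0 at [y] is
   a dummy, as [y] has been replaced by [u] or [v] there. *)
pose e z := if z == u then b else if z == v then c else assign xs y a 0 z.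
have fresh w : w \notin y :: xs ++ vars A -> w \notin bv A /\ w \notin y :: xs.
  rewrite !inE mem_cat !negb_or => /and3P [-> -> hw]; split=> //.
  by apply: contra hw => /bv_vars.
have [bu fu] := fresh _ hu; have [bw fw] := fresh _ hv.
have E w d : e w = d -> sat (assign xs y a d) A ->
    w \notin bv A -> sat e (subst (sub1 y (tVar w)) A).
  move=> ew hd bw'; rewrite sat_sub1; last exact: free_for_rename.
  apply: sat_ext_imp hd => z hz; rewrite /= ew /assign; case: eqP => // /eqP zy.
  have neq x : x \notin y :: xs -> z != x.
    by apply: contraNneq => <-; apply: hfv.
  by rewrite /e (negbTE (neq _ fu)) (negbTE (neq _ fw)) /assign (negbTE zy).
have eu : e u = b by rewrite /e eqxx.
have ev : e v = c by rewrite /e eqxx eq_sym (negbTE uv).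
by have := hval e (conj (E _ _ eu hb bu) (E _ _ ev hc bw)); rewrite /= eu ev.
Qed.

Lemma defines_in_pos Gamma n f A (xs : n.-tuple var) y :
  N_models (pos_set Gamma) ->
  defines_in (BA_plus (pos_set Gamma)) A xs y f ->
  defines_in (BA_plus (pos_set Gamma)) (pos A) xs y f.
Proof.
move=> hN [[[uxs hfv] hf] hE [u [v [uv hu hv hU]]]].
have hd : displayed (pos A) xs y by split=> // z /fv_pos /hfv.
have hU' : proves_uniqueness (BA_plus (pos_set Gamma)) (pos A) xs y.
  have fresh w : w \notin y :: xs ++ vars A -> w \notin y :: xs ++ vars (pos A).
    rewrite !inE !mem_cat !negb_or => /and3P [-> -> ]; apply: contra.
    exact: vars_pos.
  exists u, v; split=> //; [exact: fresh | exact: fresh |].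
  (* The positive part of the uniqueness sequent of [A] is literally that of [pos A], with the same
     [u] and [v]. *)
  by have := BA_plus_pos hU; rewrite /= !pos_subst.
split=> //; last exact: BA_plus_pos hE.
split=> // a b; split=> [hb|/hf]; last exact: sat_pos.
have hfa : sat (assign xs y a (f a)) (pos A) by apply/sat_pos/hf.
by apply: unique_sat hd hU' hfa hb => S; apply: BA_plus_sound.
Qed.

(** The two sequents are carried along the provable equivalence, and the defining property in N
    along its soundness. *)
Lemma defines_in_prenex Ax Ru n f A (xs : n.-tuple var) y :
  defines_in (derives Ax Ru) (pos A) xs y f ->
  exists B, [/\ Exists1pos B, equiv (pos A) B & defines_in (derives Ax Ru) B xs y f].
Proof.
move=> [[[uxs hfv] hf] hE [u [v [uv hu hv hU]]]].
(* Keeping [u] and [v] out of the prefix lets the same two variables state uniqueness for the prenex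
   form. *)
have [zs [B [qB dB fB eB]]] := pos_has_prenex A [:: u; v].
have eqS e : sat e (pos A) <-> sat e (exs zs B).
  by split; [apply: (BQC_sound (proj1 (eB _ _))) | apply: (BQC_sound (proj2 (eB _ _)))].
have [eB1 eB2] := eB Ax Ru.
have fresh w : w \in [:: u; v] -> w \notin y :: xs ++ vars (pos A) ->
    w \notin y :: xs ++ vars (exs zs B).
  move=> hw; rewrite !inE !mem_cat !negb_or => /and3P [-> -> /= wA].
  (* A variable of the prenex form is in the prefix, or is free in the matrix; outside the prefix it
     is then free in [pos A]. *)
  rewrite vars_exs (qf_pos_vars qB) mem_cat negb_or.
  have wzs : w \notin zs by apply/negP => /dB; rewrite hw.
  rewrite wzs /=; apply: contra wA => wB; apply/fv_vars/fB.
  by rewrite mem_fv_exs wB.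
have S w : w \in [:: u; v] -> w \notin y :: xs ++ vars (pos A) ->
    derives Ax Ru (subst (sub1 y (tVar w)) (exs zs B)
                   =>> subst (sub1 y (tVar w)) (pos A)).
  move=> hw hwA; have hwB := fresh _ hw hwA.
  by apply: d_sub1 eB2; apply: free_for_rename;
    [move: hwB | move: hwA]; rewrite inE mem_cat !negb_or => /and3P [_ _];
    apply: contra => /bv_vars.
exists (exs zs B); split=> //; first by exists zs, B.
split.
- split; first by split=> // w /fB /hfv.
  by move=> a b; rewrite -eqS.
- by apply: d_cut hE _; apply: d_ex_mono.
- exists u, v; split=> //; try (by apply: fresh; rewrite // !inE eqxx ?orbT).
  by apply: d_cut hU; apply: d_and_mono; apply: S; rewrite // !inE eqxx ?orbT.
Qed.

Theorem theorem3p9 (Gamma : sequent -> Prop)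
    (hN : N_models (pos_set Gamma)) :
  (forall (n : nat) (f : n.-tuple nat -> nat) (A : formula)
     (xs : n.-tuple var) (y : var),
     defines_in (BA_plus (pos_set Gamma)) A xs y f ->
     defines_in (BA_plus (pos_set Gamma)) (pos A) xs y f /\
     exists B : formula,
       [/\ Exists1pos B, BQC (pos A =>> B), BQC (B =>> pos A)
         & defines_in (BA_plus (pos_set Gamma)) B xs y f]) /\
  (forall (n : nat) (f : n.-tuple nat -> nat),
     PT (BA_plus (pos_set Gamma)) f <-> PR (BA_plus (pos_set Gamma)) f).
Proof.
split=> [n f A xs y /(defines_in_pos hN) hA|n f].
  split=> //; have [B [hB eB dB]] := defines_in_prenex hA.
  (* [BQC] is the calculus with empty sets of extra axioms and rules. *)
  by exists B; split=> //; case: (eB (fun _ => False) (fun _ _ => False)).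
split=> [[A [xs [y /(defines_in_pos hN) hA]]]|[A [xs [y [_ hA]]]]]; last by exists A, xs, y.
have [B [hB _ dB]] := defines_in_prenex hA.
by exists B, xs, y; split=> //; apply: Exists1pos_Sigma1.
Qed.
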